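(* Let $(A,\ast)$ be a Jacobi-Jordan algebra and $(V,\rho)$ a representation of it. If $T:V\to A$ is a relative Rota-Baxter operator with respect to $\rho$, then $V_T:=(V,\ast_T)$ is a Jacobi-Jordan algebra, where $$u\ast_T v:=\rho(T(u))v+\rho(T(v))u\quad\text{for } u,v\in V,$$ and $T$ is a morphism of Jacobi-Jordan algebras from $(V,\ast_T)$ to $(A,\ast)$.
   Context: All vector spaces are finite dimensional over a field $\mathbb{K}$ of characteristic $0$; an algebra is a vector space with a bilinear product, not assumed associative. A Jacobi-Jordan algebra is an algebra $(A,\ast)$ with $x\ast y=y\ast x$ and $(x\ast y)\ast z+(y\ast z)\ast x+(z\ast x)\ast y=0$ for all $x,y,z\in A$. A representation of $(A,\ast)$ is a pair $(V,\rho)$ with $V$ a vector space and $\rho:A\to gl(V)$ linear such that $\rho(x\ast y)=-\rho(x)\rho(y)-\rho(y)\rho(x)$ for all $x,y\in A$. A linear map $T:V\to A$ is a relative Rota-Baxter operator of $A$ with respect to $\rho$ if $T(u)\ast T(v)=T(\rho(T(u))v+\rho(T(v))u)$ for all $u,v\in V$. *)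

(* Defs.v *)
From mathcomp Require Import all_boot all_algebra.

Set Implicit Arguments.
Unset Strict Implicit.
Unset Printing Implicit Defensive.

Import GRing.Theory.
Local Open Scope ring_scope.

(* An algebra is a vectType together with a product [mul] on it. The product
   is kept separate from the carrier, since the same space may carry several. *)

Definition jacobi_jordan (K : fieldType) (A : vectType K)
    (mul : A -> A -> A) : Prop :=
  [/\ bilinear_for *:%R *:%R mul,
      commutative mul
    & forall x y z : A,
        mul (mul x y) z + mul (mul y z) x + mul (mul z x) y = 0].

Definition representation (K : fieldType) (A : vectType K) (mul : A -> A -> A)
    (V : vectType K) (rho : 'Hom(A, 'End(V))) : Prop :=
  forall x y : A,
    rho (mul x y) = - (rho x \o rho y)%VF - (rho y \o rho x)%VF.

Definition rrb_product (K : fieldType) (A V : vectType K)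
    (rho : 'Hom(A, 'End(V))) (T : 'Hom(V, A)) (u v : V) : V :=
  rho (T u) v + rho (T v) u.

Definition relative_rota_baxter (K : fieldType) (A : vectType K)
    (mul : A -> A -> A) (V : vectType K) (rho : 'Hom(A, 'End(V)))
    (T : 'Hom(V, A)) : Prop :=
  forall u v : V, mul (T u) (T v) = T (rho (T u) v + rho (T v) u).

(* Linearity of the morphism is carried by the type of [f]. *)
Definition algebra_morphism (K : fieldType) (A B : vectType K)
    (mulA : A -> A -> A) (mulB : B -> B -> B) (f : 'Hom(A, B)) : Prop :=
  forall x y : A, f (mulA x y) = mulB (f x) (f y).

(* Main.v *)
Require Import Defs.
From mathcomp Require Import all_boot all_algebra.
Import GRing.Theory.
Local Open Scope ring_scope.

(** The operator identity says exactly that [T] is multiplicative, so the morphism claim is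
    immediate. For Jacobi, multiplicativity turns the action of [T (u * v)] into that of
    [mul (T u) (T v)], which the representation law expands ([rrb_product_iter]); the terms then
    cancel in the cyclic sum ([rrb_product_jacobi]). *)

Lemma rrb_product_bilinear (K : fieldType) (A V : vectType K)
    (rho : 'Hom(A, 'End(V))) (T : 'Hom(V, A)) :
  bilinear_for *:%R *:%R (rrb_product rho T).
Proof.
split=> u a x y; rewrite /rrb_product !linearP add_lfunE scale_lfunE /=.
  by rewrite scalerDr addrACA.
by rewrite scalerDr addrACA.
Qed.

Lemma rrb_productC (K : fieldType) (A V : vectType K)
    (rho : 'Hom(A, 'End(V))) (T : 'Hom(V, A)) :
  commutative (rrb_product rho T).
Proof. by move=> u v; rewrite /rrb_product addrC. Qed.

(** The four terms are grouped so that each difference changes sign when the outermost and innermost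
    vectors are swapped; this sets up the cyclic cancellation. *)
Lemma rrb_product_iter (K : fieldType) (A V : vectType K) (mul : A -> A -> A)
    (rho : 'Hom(A, 'End(V))) (T : 'Hom(V, A)) (u v w : V) :
  representation mul rho -> relative_rota_baxter mul rho T ->
  rrb_product rho T (rrb_product rho T u v) w =
  (rho (T w) (rho (T v) u) - rho (T u) (rho (T v) w)) +
  (rho (T w) (rho (T u) v) - rho (T v) (rho (T u) w)).
Proof.
move=> hrho hT; rewrite /rrb_product -hT hrho !linearD.
rewrite add_lfunE !opp_lfunE !comp_lfunE.
by rewrite [X in _ + X]addrC addrACA; congr (_ + _); rewrite addrC.
Qed.

Lemma rrb_product_jacobi (K : fieldType) (A V : vectType K)
    (mul : A -> A -> A) (rho : 'Hom(A, 'End(V))) (T : 'Hom(V, A)) :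
  representation mul rho -> relative_rota_baxter mul rho T ->
  forall u v w : V,
    rrb_product rho T (rrb_product rho T u v) w
    + rrb_product rho T (rrb_product rho T v w) u
    + rrb_product rho T (rrb_product rho T w u) v = 0.
Proof.
move=> hrho hT u v w; rewrite !(rrb_product_iter _ _ _ _ _ _ _ _ _ hrho hT).
(* Here [a], [b], [e] stand for [rho (T x) (rho (T y) z)] with [(x, y, z)] equal to [(u, v, w)],
   [(v, u, w)], [(v, w, u)]; [d], [c], [f] are these with [x] and [z] exchanged. Each difference
   occurs once with each sign. *)
have cancel (a b c d e f : V) :
    (d - a) + (c - b) + ((f - e) + (a - d)) + ((b - c) + (e - f)) = 0.
  rewrite -(opprB d a) -(opprB c b) -(opprB f e) -opprD.
  by rewrite [d - a + _]addrC addrACA subrr addr0 subrr.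
exact: cancel.
Qed.

Theorem proposition3p6 (K : fieldType) (charK0 : [pchar K] =i pred0)
    (A : vectType K) (mul : A -> A -> A) (hA : jacobi_jordan mul)
    (V : vectType K) (rho : 'Hom(A, 'End(V))) (hrho : representation mul rho)
    (T : 'Hom(V, A)) (hT : relative_rota_baxter mul rho T) :
  jacobi_jordan (rrb_product rho T)
  /\ algebra_morphism (rrb_product rho T) mul T.
Proof.
split; last by move=> u v; rewrite hT.
split; first exact: rrb_product_bilinear.
  exact: rrb_productC.
exact: rrb_product_jacobi hT.
Qed.
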